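(* Let $p\ge1$ and $s\ge2$ be integers. Then the number of arithmetical structures on the coconut tree $\mathcal{CT}(p,s)$ is \[|\mathrm{Arith}(\mathcal{CT}(p,s))|=\sum_{j=0}^{s}\binom{s}{j}A(p+s-j,\,s-j),\] where $A(x,0)=C_{x-1}$ for $x\ge1$, $A(x,1)=C_{x-1}-C_{x-2}$ for $x\ge2$, and \[A(x,y)=\sum_{i=y+1}^{x}B(x-y-1,\,x-i)\,\bigl|\mathrm{SArith}(\mathcal{CT}(i-y,y))\bigr|\quad\text{for } x\ge3,\ y\ge2.\]
   Context: The coconut tree $\mathcal{CT}(p,s)$ ($p\ge1$, $s\ge0$) is the graph with vertices $v_1,\dots,v_p,v_{\ell_1},\dots,v_{\ell_s}$ and edges $v_iv_{i+1}$ ($1\le i\le p-1$) and $v_pv_{\ell_j}$ ($1\le j\le s$). An arithmetical structure on a finite connected simple graph $G$ is a pair $(\mathbf{d},\mathbf{r})$ of vectors of positive integers indexed by the vertices with $(\operatorname{diag}(\mathbf{d})-A)\mathbf{r}=\mathbf{0}$ ($A$ the adjacency matrix), i.e. $d_vr_v$ equals the sum of $r_u$ over neighbors $u$ of $v$, and the entries of $\mathbf{r}$ have gcd $1$; $\mathrm{Arith}(G)$ is the set of these. On $\mathcal{CT}(p,s)$ write $\mathbf{d}=(d_1,\dots,d_p,d_{\ell_1},\dots,d_{\ell_s})$. Such a structure is smooth if $d_1,\dots,d_{p-1},d_{\ell_1},\dots,d_{\ell_s}\ge2$; $\mathrm{SArith}(\mathcal{CT}(p,s))$ is the set of smooth arithmetical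 structures. $C_n=\frac{1}{n+1}\binom{2n}{n}$ is the $n$th Catalan number, and $B(n,k)=\frac{n-k+1}{n+1}\binom{n+k}{n}$ ($0\le k\le n$) are the ballot numbers. *)

(* Defs.v *)
From mathcomp Require Import all_boot zify finmap.
From mathcomp Require Import classical_sets functions cardinality.

Set Implicit Arguments.
Unset Strict Implicit.
Unset Printing Implicit Defensive.

Local Open Scope classical_set_scope.
Local Open Scope nat_scope.

(* The library number is 0 on infinite sets, so finiteness must be asserted
   separately where it matters. *)
Definition ncard (T : choiceType) (A : set T) : nat := #|` fset_set A|.

(* A graph is given by its adjacency relation [e]; a structure is the pair
   [(d, r)].  The third clause is (diag d - A) r = 0 read row by row. *)
Definition Arith (T : finType) (e : rel T) : set ({ffun T -> nat} * {ffun T -> nat}) :=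
  [set dr : {ffun T -> nat} * {ffun T -> nat} |
     [/\ forall v, 0 < dr.1 v,
                forall v, 0 < dr.2 v,
                forall v, dr.1 v * dr.2 v = \sum_(u | e v u) dr.2 u
              & \big[gcdn/0]_v dr.2 v = 1]].

(* [inl i] is the path vertex v_(i+1) and [inr j] the leaf v_(l_(j+1)). *)
Definition coconut (p s : nat) : rel ('I_p + 'I_s) :=
  fun u v =>
    match u, v with
    | inl i, inl k => (i.+1 == k) || (k.+1 == i)
    | inl i, inr _ => i.+1 == p
    | inr _, inl k => k.+1 == p
    | inr _, inr _ => false
    end.

(* No condition is put on d at the last path vertex v_p. *)
Definition SArith (p s : nat) :
    set ({ffun 'I_p + 'I_s -> nat} * {ffun 'I_p + 'I_s -> nat}) :=
  [set dr : {ffun _ -> nat} * {ffun _ -> nat} |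
     [/\ Arith (@coconut p s) dr,
                forall i : 'I_p, i.+1 < p -> 2 <= dr.1 (inl i)
              & forall j : 'I_s, 2 <= dr.1 (inr j)]].

Definition catalan (n : nat) : nat := 'C(2 * n, n) %/ n.+1.

Definition ballot (n k : nat) : nat := ((n - k + 1) * 'C(n + k, n)) %/ n.+1.

Definition coefA (x y : nat) : nat :=
  match y with
  | 0 => catalan (x - 1)
  | 1 => catalan (x - 1) - catalan (x - 2)
  | _ => \sum_(y.+1 <= i < x.+1)
           ballot (x - y - 1) (x - i) * ncard (@SArith (i - y) y)
  end.

(* [coconut p s] is a connected simple graph. *)
Lemma coconut_sym p s : symmetric (@coconut p s).
Proof. by move=> [i|i] [k|k] //=; rewrite orbC. Qed.

Lemma coconut_irr p s : irreflexive (@coconut p s).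
Proof. by move=> [i|i] //=; rewrite orbb; apply/eqP => /eqP; rewrite eqn_leq ltnn. Qed.

Lemma coconut_connected p s (u v : 'I_p + 'I_s) : 0 < p -> connect (@coconut p s) u v.
Proof.
case: p u v => // p u v _.
have csym : connect_sym (@coconut p.+1 s).
  exact/sym_connect_sym/coconut_sym.
suff H w : connect (@coconut p.+1 s) (inl ord0) w.
  by apply: (connect_trans (y := inl ord0)); first rewrite csym.
have Hl n (Hn : n < p.+1) : connect (@coconut p.+1 s) (inl ord0) (inl (Ordinal Hn)).
  elim: n Hn => [|n IH] Hn.
    by rewrite (_ : Ordinal Hn = ord0) ?connect0 //; apply: val_inj.
  by apply: connect_trans (IH (ltnW Hn)) (connect1 _); rewrite /= eqxx.
case: w => [[n Hn]|j]; first exact: Hl.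
by apply: connect_trans (Hl p (ltnSn p)) (connect1 _); rewrite /= eqxx.
Qed.

(* The quotients and the difference in [catalan], [ballot] and [coefA] are
   exact on the ranges where they are used. *)
Lemma ballotE n k : k <= n -> n.+1 * ballot n k = (n - k + 1) * 'C(n + k, n).
Proof.
move=> kn; rewrite /ballot mulnC divnK //.
have H : n.+1 * 'C(n + k, n.+1) = k * 'C(n + k, n) by rewrite mul_bin_left addKn.
have -> : n - k + 1 = n.+1 - k by rewrite addn1 subSn.
by rewrite mulnBl -H -mulnBr dvdn_mulr.
Qed.

Lemma catalanE n : n.+1 * catalan n = 'C(2 * n, n).
Proof.
have := ballotE (leqnn n); rewrite /ballot /catalan subnn add0n mul1n.
by rewrite addnn -mul2n.
Qed.

Lemma catalanS n : n.+2 * catalan n.+1 = (4 * n + 2) * catalan n.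
Proof.
apply/eqP; rewrite -(eqn_pmul2l (ltn0Sn n)) (catalanE n.+1) mulnCA catalanE.
have -> : 2 * n.+1 = (2 * n).+2 by rewrite mulnS.
rewrite -mul_bin_diag /= -(eqn_pmul2l (ltn0Sn n)).
have e : n.+1 * 'C((2 * n).+1, n) = (2 * n).+1 * 'C(2 * n, n).
  by rewrite mul_bin_down; congr (_ * _); lia.
rewrite mulnCA e; apply/eqP; move: 'C(2 * n, n) => c; nia.
Qed.

Lemma catalan_le n : catalan n <= catalan n.+1.
Proof.
rewrite -(leq_pmul2l (ltn0Sn n.+1)) catalanS leq_mul2r; apply/orP; right.
by rewrite -[n.+2]addn2 leq_add2r leq_pmull.
Qed.

(* Main.v *)
(* A structure on CT(n+1,s) is determined by the entry R of r at v_(n+1), the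
   entries c = (r_n, ..., r_1) on the rest of the path and the leaf entries l.
   The equations at v_1, ..., v_n say that every entry of c divides the sum of
   its two neighbours (with r_0 = 0); the equations at the leaves say that
   every l_j divides R; the one at v_(n+1) says that R divides r_n + sum_j l_j.
   The last condition and the gcd condition see only a = r_n mod R, so the
   structures over a fixed (R, a, l) are counted by the chains c over (R, a).
   If the Euclidean algorithm with remainders rounded upwards takes m steps on
   (a, R), then removing the first entry b = a + tR of c leaves a chain over
   (-R mod b, b), whose algorithm takes m + t - 1 steps; this recursion yields
   the ballot number B(n, n-m).  A chain with n = m is the strictly decreasing
   one, i.e. the smooth one, so triples with l_j < R for all j and m steps are
   the same as smooth structures on CT(m+1,s).  A leaf with l_j = R changes no
   condition on the triple and can be dropped.
   Finiteness holds on every connected graph: by symmetry of the adjacency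
   matrix the vectors d form an antichain, so Dickson's lemma applies. *)
From mathcomp Require Import all_boot zify finmap.
From mathcomp Require Import boolp classical_sets functions cardinality.
Require Import Defs.

Set Implicit Arguments.
Unset Strict Implicit.
Unset Printing Implicit Defensive.

Local Open Scope classical_set_scope.
Local Open Scope nat_scope.

(** * Ballot numbers and chains *)

(** Removes the quotient from [ballot], so that the recurrences below reduce to Pascal's rule and
    linear arithmetic. *)
Lemma ballot_bin n k : k <= n -> ballot n k + 'C(n + k, n.+1) = 'C(n + k, n).
Proof.
move=> kn; apply/eqP; rewrite -(eqn_pmul2l (ltn0Sn n)) mulnDr ballotE //.
by rewrite mul_bin_left addKn -mulnDl; apply/eqP; congr (_ * _); lia.
Qed.

Lemma ballot0 n : ballot n 0 = 1.
Proof. by have := @ballot_bin n 0 isT; rewrite addn0 binn bin_small // addn0. Qed.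

Lemma ballotSS n k : k < n ->
  ballot n.+1 k.+1 = ballot n.+1 k + ballot n k.+1.
Proof.
move=> kn.
have := @ballot_bin n.+1 k.+1 (ltnW kn : k < n.+1).
have := @ballot_bin n.+1 k (leqW (ltnW kn)).
have := @ballot_bin n k.+1 kn.
rewrite !addSn !addnS !binS; lia.
Qed.

Lemma ballot_diag n : ballot n.+1 n.+1 = ballot n.+1 n.
Proof.
have := @ballot_bin n.+1 n.+1 (leqnn _).
have := @ballot_bin n.+1 n (leqnSn _).
have -> : n.+1 + n.+1 = (n.+1 + n).+1 by lia.
rewrite [in 'C((_ + _).+1, n.+1)]binS [in 'C((_ + _).+1, n.+2)]binS.
have -> : 'C(n.+1 + n, n.+1) = 'C(n.+1 + n, n).
  by rewrite -[RHS]bin_sub; [congr 'C(_, _); lia|lia].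
lia.
Qed.

Lemma ballot_catalan n : ballot n n = catalan n.
Proof. by rewrite /ballot /catalan subnn add0n mul1n addnn mul2n. Qed.

(* The number of chains of length [n] over a pair with [m] Euclidean steps,
   see [size_chains]. *)
Definition cballot n m := if m <= n then ballot n (n - m) else 0.

Lemma cballotSS n m : cballot n.+1 m.+1 = cballot n m + cballot n.+1 m.+2.
Proof.
rewrite /cballot !ltnS subSS; case: (leqP m n) => [mn|nm]; last by rewrite ltnNge ltnW.
case: (ltnP m n) => [mn'|nm].
  have e : n - m = (n - m.+1).+1 by lia.
  rewrite e ballotSS; last by lia.
  by rewrite subSS -e addnC.
have -> : n - m = 0 by lia.
by rewrite !ballot0.
Qed.

Lemma cballotS0 n : cballot n.+1 0 = cballot n.+1 1.
Proof. by rewrite /cballot /= subn0 subSS subn0 ballot_diag. Qed.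

Lemma cballot_small n m : n < m -> cballot n m = 0.
Proof. by rewrite /cballot ltnNge; case: leqP. Qed.

Lemma cballot_catalan n : cballot n 0 = catalan n.
Proof. by rewrite /cballot subn0 ballot_catalan. Qed.

(** The recurrence [cballotSS] telescopes; the hypothesis makes the tail left after [k] terms
    vanish. *)
Lemma sum_cballot n m k : n < m + k ->
  \sum_(0 <= i < k) cballot n (m + i) = cballot n.+1 m.+1.
Proof.
elim: k m => [|k IH] m nm.
  by rewrite big_geq // cballot_small //; lia.
rewrite big_nat_recl // addn0 cballotSS -[in RHS]IH; last by lia.
by congr (_ + _); apply: eq_bigr => i _; rewrite addnS addSn.
Qed.

(** * The Euclidean algorithm with remainders rounded upwards *)

Definition oppm R b := (b - R %% b) %% b.

Lemma oppmP R b x : 0 < b -> x < b -> (b %| R + x) = (oppm R b == x).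
Proof.
move=> b0 xb; have rb := ltn_pmod R b0.
rewrite /dvdn -modnDml /oppm.
have [r0|r0] := posnP (R %% b).
  by rewrite r0 add0n subn0 modnn modn_small // eq_sym.
rewrite [in RHS]modn_small; last by lia.
apply/eqP/eqP => [|<-]; last by rewrite subnKC ?modnn // ltnW.
by move: (R %% b) rb r0 => r rb r0 /eqP/dvdnP[[|[|q]] e]; lia.
Qed.

Lemma ltn_oppm R b : 0 < b -> oppm R b < b.
Proof. exact: ltn_pmod. Qed.

Lemma oppm_addl R b : oppm (b + R) b = oppm R b.
Proof. by rewrite /oppm modnDl. Qed.

Lemma oppm_small R b : 0 < R <= b -> oppm R b = b - R.
Proof.
move=> /andP[R0 Rb]; apply/eqP; rewrite -oppmP; [|lia|lia].
by rewrite subnKC.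
Qed.

(** [k] is fuel. For [0 < a] one has [oppm R a < a], so the first entry of the pair strictly
    decreases and fuel [a] suffices. *)
Fixpoint elen_rec k a R :=
  if k is k'.+1 then if a == 0 then 0 else (elen_rec k' (oppm R a) a).+1 else 0.

(* Number of division steps, with remainders rounded upwards, in the
   Euclidean algorithm on [(a, R)]. *)
Definition elen a R := elen_rec a a R.

Lemma elen0 R : elen 0 R = 0. Proof. by []. Qed.

Lemma elenS a R : 0 < a -> elen a R = (elen (oppm R a) a).+1.
Proof.
have fuel k k' b S : b <= k -> b <= k' -> elen_rec k b S = elen_rec k' b S.
  elim: k k' b S => [|k IH] [|k'] [|b] S //= bk bk'.
  have := @ltn_oppm S b.+1 isT => h.
  by congr _.+1; apply: IH; lia.
rewrite /elen; case: a => // a _ /=; congr _.+1.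
by apply: fuel => //; rewrite -ltnS ltn_oppm.
Qed.

Lemma elen_addl a R : elen a (a + R) = elen a R.
Proof. by case: (posnP a) => [->|a0] //; rewrite elenS // oppm_addl -elenS. Qed.

(** Here [oppm] subtracts [R]: one step lowers both entries of the pair by [R]. *)
Lemma elen_shift a R t : 0 < R ->
  elen (a + t * R) (a + t.+1 * R) = elen a R + t.
Proof.
move=> R0; elim: t => [|t IH]; first by rewrite !addn0 mul1n elen_addl.
rewrite [a + t.+2 * R](_ : _ = a + t.+1 * R + R); last by lia.
rewrite elenS ?oppm_addl; last by lia.
rewrite oppm_small; last by lia.
by rewrite (_ : _ - R = a + t * R) ?IH ?addnS //; lia.
Qed.

(** Write b = a + tR with a < R. For t = 0 this is a single step of the algorithm; for t > 0 the
    pair on the left is (a + (t-1)R, a + tR), and [elen_shift] counts its steps. *)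
Lemma elen_divn b R : 0 < b -> 0 < R ->
  (elen (oppm R b) b).+1 = elen (b %% R) R + b %/ R.
Proof.
move=> b0 R0; have := divn_eq b R; have := ltn_pmod b R0.
move: (b %/ R) (b %% R) => t a aR eb.
case: t eb => [|t] eb.
  by rewrite mul0n add0n in eb; rewrite addn0 -eb -elenS.
rewrite oppm_small; last by nia.
rewrite eb addnS (_ : _ - R = a + t * R); last by nia.
by rewrite [_ * R + a]addnC elen_shift.
Qed.

(* [c] lists the entries that precede [R] on the path, nearest first; the
   default of [head] plays the role of r_0 = 0. *)
Fixpoint chain R (c : seq nat) : bool :=
  if c is b :: c' then [&& 0 < b, b %| R + head 0 c' & chain b c'] else true.

Lemma chain_oppm R b x : 0 < b -> b %| R + x -> oppm R b = x %% b.
Proof.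
by move=> b0 h; apply/eqP; rewrite -oppmP ?ltn_pmod // /dvdn modnDmr.
Qed.

(** The quotient is kept in the bound because it limits which multiples of [R] can occur in the
    first entry, which makes the search in [chains] finite. *)
Lemma chain_elen R c : 0 < R -> chain R c ->
  elen (head 0 c %% R) R + head 0 c %/ R <= size c.
Proof.
elim: c R => [|b c IH] R R0 /=; first by rewrite mod0n div0n.
case/and3P=> b0 bR cc; rewrite -elen_divn // (chain_oppm b0 bR) ltnS.
by apply: leq_trans (leq_addr _ _) (IH _ b0 cc).
Qed.

(** If b >= R for the first entry b, then b / R >= 1, and by [elen_divn] the pair at [R] takes no
    more steps than the pair at b. Hence the count stays below the length of the chain. *)
Lemma chain_smooth R c : 0 < R -> chain R c ->
  (elen (head 0 c %% R) R == size c) = path gtn R c.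
Proof.
elim: c R => [|b c IH] R R0 /=; first by rewrite mod0n.
case/and3P=> b0 bR cc; have := elen_divn b0 R0; rewrite (chain_oppm b0 bR).
rewrite -IH //; have := chain_elen b0 cc.
case: (ltnP b R) => [bR'|Rb] /=; first by rewrite (divn_small bR') addn0 => _ <-.
have : 0 < b %/ R by rewrite divn_gt0.
move: (b %/ R) (_ %/ b) (elen _ b) (elen _ R) => *; lia.
Qed.

(** * Listing and counting the chains over a fixed pair *)

Fixpoint chains n a R : seq (seq nat) :=
  if n is n'.+1 then
    [seq b :: c | b <- [seq a + t * R | t <- iota 0 n.+1 & 0 < a + t * R],
                  c <- chains n' (oppm R b) b]
  else if a == 0 then [:: [::]] else [::].

(** The multipliers t <= n are enough by [chain_elen]. The empty chain has head 0, which is why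
    length 0 requires a = 0. *)
Lemma mem_chains n a R c : a < R ->
  (c \in chains n a R) = [&& size c == n, chain R c & head 0 c %% R == a].
Proof.
elim: n a R c => [|n IH] a R c aR.
  rewrite /=; case: (eqVneq a 0) => [->|a0]; case: c => [|b c] //=.
    by rewrite mod0n eqxx.
  by rewrite mod0n eq_sym (negPf a0).
have R0 : 0 < R by lia.
apply/allpairsPdep/and3P => [[b [c' []]]|[/eqP sz cc /eqP ha]].
  case/mapP=> t; rewrite mem_filter => /andP[b0 _] eb; rewrite -eb in b0.
  rewrite IH ?ltn_oppm // => /and3P[/eqP sz cc /eqP hc] -> /=.
  rewrite sz b0 cc eqxx eb addnC modnMDl modn_small // eqxx addnC -eb.
  by rewrite /= andbT /dvdn -modnDmr hc -[_ == 0]/(b %| _) oppmP ?ltn_oppm ?eqxx.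
have := chain_elen R0 cc; rewrite sz ha => hb.
case: c sz cc ha hb => // b c' [sz] /and3P[b0 bR cc] ha hb.
have eb : b = a + b %/ R * R by rewrite /= in ha; rewrite -ha addnC -divn_eq.
exists b, c'; split=> //.
  apply/mapP; exists (b %/ R) => //; rewrite mem_filter mem_iota -eb b0 /=.
  by rewrite add0n ltnS; apply: leq_trans hb; apply: leq_addl.
rewrite IH ?ltn_oppm // sz (chain_oppm b0 bR) !eqxx andbT; exact: cc.
Qed.

Lemma chains_uniq n a R : 0 < R -> uniq (chains n a R).
Proof.
elim: n a R => [|n IH] a R R0; first by rewrite /=; case: ifP.
apply: allpairs_uniq_dep.
- rewrite map_inj_uniq ?filter_uniq ?iota_uniq // => t u /addnI/eqP.
  by rewrite eqn_pmul2r // => /eqP.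
- by move=> b /mapP[t]; rewrite mem_filter => /andP[b0 _] ->; apply: IH.
- by move=> [b c] [b' c'] _ _ /= [-> ->].
Qed.

(** By [elen_divn] a first entry a + tR leaves m + t - 1 steps, and the sum over t >= 1 telescopes
    by [sum_cballot]. The term t = 0 is present only when a > 0; the two cases match [cballotS0] and
    [cballotSS]. *)
Lemma size_chains n a R : a < R -> size (chains n a R) = cballot n (elen a R).
Proof.
elim: n a R => [|n IH] a R aR.
  case: (posnP a) => [->|a0] //=.
  by rewrite elenS // cballot_small //= (gtn_eqF a0).
have R0 : 0 < R by lia.
have step t : 0 < a + t * R ->
    size (chains n (oppm R (a + t * R)) (a + t * R)) =
    cballot n (elen a R + t).-1.
  move=> b0; rewrite IH ?ltn_oppm //; congr cballot.
  have := elen_divn b0 R0.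
  by rewrite addnC modnMDl modn_small // divnMDl // divn_small // addn0 => <-.
rewrite size_allpairs_dep sumnE !big_map big_filter.
rewrite (eq_bigr (fun t => cballot n (elen a R + t).-1)) => [|t /step //].
rewrite -[iota 0 n.+2]/(index_iota 0 n.+2) big_mkcond big_nat_recl //= addn0.
rewrite addn0 (eq_bigr (fun t => cballot n (elen a R + t))); last first.
  by move=> t _; rewrite ifT ?addnS //; lia.
rewrite sum_cballot; last by lia.
case: (posnP a) => [->|a0]; first by rewrite elen0 cballotS0.
by rewrite elenS //= -cballotSS.
Qed.

(** * Finiteness *)

(** Repeatedly choose an index at which the remaining tail attains its minimum. *)
Lemma subseq_homo (u : nat -> nat) :
  {f : nat -> nat | {homo f : i j / i < j} & {homo (u \o f) : i j / i <= j}}.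
Proof.
have min N : exists n, N <= n /\ forall m, N <= m -> u n <= u m.
  have ex : exists v, `[< exists2 n, N <= n & u n = v >].
    by exists (u N); apply/asboolP; exists N.
  case: (ex_minnP ex) => v /asboolP[n Nn <-] vmin; exists n; split=> // m Nm.
  by apply: vmin; apply/asboolP; exists m.
have [g gP] := choice min.
pose f i := iter i (fun k => g k.+1) (g 0).
have fS i : f i < f i.+1 by have [] := gP (f i).+1.
exists f; first by apply: homo_ltn => // *; apply: ltn_trans; eassumption.
apply: homo_leq => // [*|i]; first by apply: leq_trans; eassumption.
rewrite /=; case: i => [|i]; last have [_ h] := gP (f i).+1.
  by have [_] := gP 0; apply.
by apply: h; apply: ltn_trans (fS i.+1); apply: fS.
Qed.

(** Extract once per coordinate; a further extraction keeps the monotonicity already obtained. *)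
Lemma dickson (T : eqType) (l : seq T) (u : nat -> T -> nat) :
  {f : nat -> nat | {homo f : i j / i < j} &
     forall x, x \in l -> {homo (fun i => u (f i) x) : i j / i <= j}}.
Proof.
elim: l => [|y l [f f_lt uf]]; first by exists id.
have [g g_lt ug] := subseq_homo (fun i => u (f i) y).
exists (f \o g) => [i j ij|x]; first by apply/f_lt/g_lt.
rewrite inE => /predU1P[-> //|xl i j ij].
by apply: uf => //; apply: ltnW_homo ij => ? ? ?; apply: g_lt.
Qed.

(** An infinite set contains an injective sequence, and [dickson] makes two of its terms comparable,
    hence equal. *)
Lemma finite_antichain (T : finType) (X : choiceType) (A : set X)
    (d : X -> T -> nat) :
    (forall x y, A x -> A y -> (forall t, d x t <= d y t) -> x = y) ->
  finite_set A.
Proof.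
elim/choicePpointed: X => X in A d *; first by rewrite emptyE => _; apply: finite_set0.
move=> anti; apply: contrapT => /infiniteP/ppcard_leP[f].
have [g g_lt ug] := dickson (enum T) (fun i => d (f i)).
have fA i : A (f i) by apply: funS.
have : f (g 0) = f (g 1).
  by apply: anti => // t; apply: (ug t); rewrite ?mem_enum.
by move=> /inj; rewrite !inE => /(_ I I) e; have := g_lt 0 1 isT; rewrite e ltnn.
Qed.

Lemma ncard_seq (T : choiceType) (A : set T) (s : seq T) :
  uniq s -> (forall x, x \in s <-> A x) -> ncard A = size s.
Proof.
move=> us sA; have -> : A = [set` [fset x in s]%fset]%classic.
  by apply/seteqP; split=> x /=; rewrite inE /= => /sA.
by rewrite /ncard set_fsetK card_fseq undup_id.
Qed.

Lemma ncard_image (T U : choiceType) (f : T -> U) (A : set T) :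
    finite_set A -> (forall x y, A x -> A y -> f x = f y -> x = y) ->
  ncard (f @` A)%classic = ncard A.
Proof.
move=> finA finj; rewrite /ncard fset_set_image // card_in_imfset //= => x y.
by rewrite !in_fset_set // !inE; apply: finj.
Qed.

Lemma dvdn_mul_biggcd (T : finType) (r : T -> nat) k l :
    \big[gcdn/0]_v r v = 1 -> (forall v, k %| r v * l) -> k %| l.
Proof.
move=> r1 kr; rewrite -(mul1n l) -r1.
rewrite (big_morph (fun x => x * l) (id1 := 0) (op1 := gcdn)) //.
  by apply/dvdn_biggcdP => v _.
by move=> x y; rewrite muln_gcdl.
Qed.

Section FiniteArith.
Variables (T : finType) (e : rel T).
Hypotheses (e_sym : symmetric e) (e_conn : forall u v, connect e u v).
Implicit Types x y : {ffun T -> nat} * {ffun T -> nat}.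

(* Symmetry of the adjacency matrix gives
   [\sum_v d_v r_v r'_v = \sum_v d'_v r_v r'_v]. *)
Lemma Arith_antichain x y : Arith e x -> Arith e y ->
  (forall v, x.1 v <= y.1 v) -> x.1 = y.1.
Proof.
case: x y => [d r] [d' r'] /= [_ r0 rE _] [_ r'0 r'E _] /= dd'.
have e_sum : \sum_v d v * (r v * r' v) = \sum_v d' v * (r v * r' v).
  transitivity (\sum_v \sum_(u | e v u) r u * r' v).
    by apply: eq_bigr => v _; rewrite mulnA rE big_distrl.
  rewrite (exchange_big_dep xpredT) //=; apply: eq_bigr => u _.
  rewrite mulnCA r'E mulnC big_distrl /= [RHS](eq_bigl (e^~ u)).
    by apply: eq_bigr => v _; rewrite mulnC.
  by move=> v; rewrite e_sym.
have le v : d v * (r v * r' v) <= d' v * (r v * r' v) ?= iff (d v == d' v).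
  split; first by rewrite leq_mul2r dd' orbT.
  by rewrite eqn_pmul2r // muln_gt0 r0 r'0.
have [_] := leqif_sum (P := xpredT) (fun v _ => le v).
rewrite e_sum eqxx => /esym/forallP h.
by apply/ffunP => v; apply/eqP; have := h v.
Qed.

(** A maximum principle: at a vertex where the ratio r / r' is maximal, the common equation forces
    the same ratio at every neighbour. By connectedness r and r' are proportional, and gcd 1 on both
    sides makes them equal. *)
Lemma Arith_inj x y : Arith e x -> Arith e y -> x.1 = y.1 -> x = y.
Proof.
case: x y => [d r] [d' r'] [/= _ r0 rE r1] [/= _ r'0 r'E r'1] dd'.
subst d'; congr pair; apply/ffunP.
have [v0 _|noT] := pickP (@predT T); last first.
  by move=> v; have := noT v.
pose ord u v := r v * r' u <= r u * r' v.
have [w wP] : exists w, forall u, ord w u.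
  have ord_refl : reflexive ord by move=> u; apply: leqnn.
  have ord_tr : transitive ord.
    move=> v u t; rewrite /ord => vu tv; rewrite -(leq_pmul2r (r0 v)).
    apply: (@leq_trans (r v * r' u * r t)); first by lia.
    apply: (@leq_trans (r u * (r t * r' v))); first by rewrite mulnA; nia.
    by nia.
  have ord_tot : total ord by move=> u v; apply: leq_total.
  have [w _ wP] := @extremumP _ _ ord v0 xpredT id ord_refl ord_tr ord_tot isT.
  by exists w => u; apply: wP.
have prop v : connect e w v -> r v * r' w = r w * r' v.
  case/connectP => p ep ->{v}; elim/last_ind: p ep => [|p v IH] //.
  rewrite rcons_path last_rcons => /andP[/IH{}IH ev].
  set u := last w p in IH ev.
  have le t : e u t -> r t * r' w <= r w * r' t ?= iff (r t * r' w == r w * r' t).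
    by split=> //; apply: wP.
  have [_] := leqif_sum le.
  have -> : \sum_(i | e u i) r i * r' w = \sum_(i | e u i) r w * r' i.
    by rewrite -big_distrl -big_distrr /= -rE -r'E -mulnA IH mulnCA.
  by rewrite eqxx => /esym/forallP/(_ v)/implyP/(_ ev)/eqP.
have eqw : r w = r' w.
  apply/eqP; rewrite eqn_dvd (dvdn_mul_biggcd r1) => [|v]; last first.
    by rewrite prop // dvdn_mulr.
  by rewrite (dvdn_mul_biggcd r'1) // => v; rewrite mulnC -prop // dvdn_mull.
move=> v; apply/eqP; rewrite -(eqn_pmul2r (r'0 w)) prop // eqw mulnC.
exact: eqxx.
Qed.

Lemma finite_Arith : finite_set (Arith e).
Proof.
apply: (finite_antichain (d := fun x v => x.1 v)) => x y Ax Ay xy.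
by apply: Arith_inj => //; apply: Arith_antichain.
Qed.

End FiniteArith.

(** * Structures on the coconut tree *)

Lemma chainP R c :
  reflect (forall k, k < size c ->
             0 < nth 0 c k /\ nth 0 c k %| nth 0 (R :: c) k + nth 0 c k.+1)
          (chain R c).
Proof.
elim: c R => [|b c IH] R /=; first exact: ReflectT.
apply: (iffP and3P) => [[b0 bR /IH cc] [|k] kc|h].
- by rewrite nth0.
- exact: cc.
- split; [by have [] := h 0 isT|by have [_] := h 0 isT; rewrite /= nth0|].
  by apply/IH => k kc; have := h k.+1 kc.
Qed.

Lemma chain_dvd R c d :
  chain R c -> d %| R -> d %| head 0 c -> forall k, d %| nth 0 c k.
Proof.
elim: c R => [|b c IH] R /=; first by move=> _ _ _ k; rewrite nth_nil dvdn0.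
case/and3P=> _ bR cc dR db [|k] //=; apply: (IH b) => //.
by rewrite -(dvdn_addr _ dR); apply: dvdn_trans bR.
Qed.

(** The inequalities say d >= 2 along the path. If b < R, the quotient (R + h) / b exceeds 1, where
    h follows b. Conversely, working from the far end, h < b and 2b <= R + h give b < R. *)
Lemma chain_pathP R c : chain R c -> 
  reflect (forall k, k < size c -> 2 * nth 0 c k <= nth 0 (R :: c) k + nth 0 c k.+1)
          (path gtn R c).
Proof.
elim: c R => [|b c IH] R /=; first by move=> _; apply: ReflectT.
case/and3P=> b0 bR /IH {}IH.
have hb : path gtn b c -> head 0 c < b by case: (c) => //= ? ? /andP[].
apply: (iffP andP) => [[bltR /IH cc] [|k] kc|h]; last 1 first.
- have bc : path gtn b c by apply/IH => k kc; have := h k.+1 kc.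
  by split=> //; have := hb bc; have := h 0 isT; rewrite /= nth0 /=; lia.
- rewrite /= nth0; have [q e] := dvdnP bR; rewrite e.
  by rewrite leq_mul2r; apply/orP; right; case: q e => [|[|q]] //; lia.
- exact: cc.
Qed.

Section Coconut.
Variables n s : nat.
Implicit Types (R a : nat) (c : seq nat) (l : {ffun 'I_s -> nat}).

(** The gcd clause tests only [R], [a] and the leaves: by [chain_dvd] a common divisor of [R] and
    the first chain entry divides the whole chain. *)
Definition core R a l : Prop :=
  [/\ 0 < R, R %| a + \sum_j l j, forall j, l j %| R
    & forall d, d %| R -> d %| a -> (forall j, d %| l j) -> d = 1].

Lemma core_modn R a l : core R (a %% R) l <-> core R a l.
Proof.
have e d : d %| R -> (d %| a %% R) = (d %| a).
  by move=> dR; rewrite /dvdn modn_dvdm.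
have eR : (R %| a %% R + \sum_j l j) = (R %| a + \sum_j l j).
  by rewrite /dvdn modnDml.
by split=> -[R0 Ra lR g]; split=> [||//|d dR da]; rewrite ?eR -?eR // in Ra *;
  apply: g => //; rewrite ?e // -e.
Qed.

(* [c] lists the path entries of r read from v_(p-1) down to v_1, and [R] is
   the entry at v_p. *)
Definition rvec R c l : {ffun 'I_n.+1 + 'I_s -> nat} :=
  [ffun v : 'I_n.+1 + 'I_s =>
     match v with inl i => nth 0 (R :: c) (n - i) | inr j => l j end].

Lemma sum_coconut_path R c l (i : 'I_n.+1) : size c = n ->
  \sum_(u | coconut (inl i) u) rvec R c l u =
  nth 0 c (n - i) + (if i < n then nth 0 (R :: c) (n - i).-1 else \sum_j l j).
Proof.
move=> sz; rewrite big_sumType /=.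
rewrite (eq_bigr (fun k : 'I_n.+1 => nth 0 (R :: c) (n - k))); last first.
  by move=> k _; rewrite ffunE.
rewrite [X in _ + X](eq_bigr l); last by move=> j _; rewrite ffunE.
rewrite (bigID (fun k : 'I_n.+1 => k.+1 == i)) /= -addnA; congr (_ + _).
  rewrite (eq_bigl (fun k : 'I_n.+1 => k.+1 == i)); last first.
    by move=> k; rewrite andb_orl; case: eqP => //=; lia.
  (* At v_1 there is no predecessor; the index n is past the end of [c], so [nth] returns its
     default 0, the value of the empty sum. *)
  case: (posnP i) => [i0|i0].
    by rewrite big1 ?nth_default // => [|k]; [lia|rewrite i0].
  have lt : i.-1 < n.+1 by have := ltn_ord i; lia.
  rewrite (big_pred1 (Ordinal lt)) /=.
    by rewrite (_ : n - i.-1 = (n - i).+1) //; have := ltn_ord i; lia.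
  by move=> k; rewrite /= -val_eqE /=; lia.
rewrite (eq_bigl (fun k : 'I_n.+1 => i.+1 == k)); last first.
  by move=> k /=; apply/idP/idP => /=; lia.
case: ltnP => [lt|ge].
  rewrite (big_pred1 (Ordinal (lt : i.+1 < n.+1))) /=; last first.
    by move=> k; rewrite /= -val_eqE eq_sym.
  rewrite [X in _ + X]big_pred0 ?addn0; first by congr nth; lia.
  by move=> j; lia.
rewrite big_pred0; last by move=> k; have := ltn_ord k; lia.
by rewrite add0n; apply: eq_bigl => j; have := ltn_ord i; lia.
Qed.

Lemma sum_coconut_leaf R c l (j : 'I_s) :
  \sum_(u | coconut (p := n.+1) (inr j) u) rvec R c l u = R.
Proof.
rewrite big_sumType /= [X in _ + X]big_pred0 // addn0.
rewrite (big_pred1 ord_max) ?ffunE ?subnn //.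
Qed.

Definition dvec R c l : {ffun 'I_n.+1 + 'I_s -> nat} :=
  [ffun v : 'I_n.+1 + 'I_s => (\sum_(u | coconut v u) rvec R c l u) %/ rvec R c l v].

Lemma Arith_rvec R c l d : size c = n -> 0 < s ->
  Arith (@coconut n.+1 s) (d, rvec R c l) <->
  [/\ core R (head 0 c) l, chain R c & d = dvec R c l].
Proof.
move=> sz s0; split=> [[/= d0 r0 rE r1]|[[R0 Ra lR g] cc ->]].
  have dE : d = dvec R c l.
    by apply/ffunP => v; rewrite ffunE -rE mulnK.
  have cc : chain R c.
    apply/chainP => k; rewrite sz => kn.
    (* Position [k] of [c] is position k + 1 of [R :: c], hence the path vertex of index n - (k +
       1). *)
    have lt : n - k.+1 < n.+1 by lia.
    have e : n - (n - k.+1) = k.+1 by lia.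
    have := r0 (inl (Ordinal lt)); have := rE (inl (Ordinal lt)).
    rewrite sum_coconut_path // ffunE /= e /= ifT; last by lia.
    by move=> eq ->; split=> //; rewrite addnC -eq dvdn_mull.
  have lR j : l j %| R.
    by have := rE (inr j); rewrite sum_coconut_leaf ffunE => <-; rewrite dvdn_mull.
  split=> //; split=> //.
  - by have := r0 (inl ord_max); rewrite ffunE subnn.
  - have := rE (inl ord_max).
    by rewrite sum_coconut_path // ffunE /= subnn ltnn nth0 => <-; rewrite dvdn_mull.
  - move=> k kR ka kl; apply/eqP; rewrite -dvdn1 -r1; apply/dvdn_biggcdP => v _.
    rewrite ffunE; case: v => [i|j] //.
    by case: (n - i) => // m; apply: chain_dvd cc kR ka m.
have cP := chainP _ _ cc.
have r0 v : 0 < rvec R c l v.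
  rewrite ffunE; case: v => [i|j].
    case e : (n - i) => [|m] //=; have /cP[] // : m < size c by lia.
  by apply: dvdn_gt0 (lR j).
have rd v : rvec R c l v %| \sum_(u | coconut v u) rvec R c l u.
  case: v => [i|j]; last by rewrite sum_coconut_leaf ffunE.
  rewrite sum_coconut_path // ffunE addnC; have := ltn_ord i.
  case: (ltnP i n) => [lt _|ge lt]; last first.
    have -> : n - i = 0 by lia.
    by rewrite addnC /= nth0.
  have e : n - i = (n - i).-1.+1 by lia.
  by rewrite e /=; have [|_] := cP (n - i).-1; first lia.
have dv v : dvec R c l v * rvec R c l v = \sum_(u | coconut v u) rvec R c l u.
  by rewrite [dvec _ _ _ _]ffunE divnK.
(* Gives d > 0. On the path before v_(n+1) the next vertex contributes a positive term; at v_(n+1) a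
   leaf does, which exists by [s0]. *)
have sum0 v : 0 < \sum_(u | coconut v u) rvec R c l u.
  case: v => [i|j]; last by rewrite sum_coconut_leaf.
  rewrite sum_coconut_path // addn_gt0; apply/orP; right.
  case: (ltnP i n) => [lt|_]; last first.
    rewrite (bigD1 (Ordinal s0)) //= addn_gt0.
    by rewrite (dvdn_gt0 _ (lR (Ordinal s0))).
  case e : (n - i) => [|[|m]] //=; have /cP[] // : m < size c by lia.
split=> //= [v|].
  by rewrite [dvec _ _ _ _]ffunE divn_gt0 // dvdn_leq.
have gcdr v : \big[gcdn/0]_u rvec R c l u %| rvec R c l v.
  by apply: (biggcdn_inf v).
apply: g => [||j].
- by have := gcdr (inl ord_max); rewrite [in X in _ %| X]ffunE subnn.
- case: (posnP n) => [n0|n0]; first by rewrite -nth0 nth_default ?dvdn0 // sz n0.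
  have lt : n.-1 < n.+1 by lia.
  have := gcdr (inl (Ordinal lt)).
  by rewrite [in X in _ %| X]ffunE /= (_ : n - n.-1 = 1) ?nth0 //; lia.
- by have := gcdr (inr j); rewrite [in X in _ %| X]ffunE.
Qed.

End Coconut.

(** * Structures encoded as chains with leaf entries *)

Section Bijections.
Variables n s : nat.
Hypothesis s_gt0 : 0 < s.
Let V := ('I_n.+1 + 'I_s)%type.
Implicit Types (R a : nat) (c : seq nat) (l : {ffun 'I_s -> nat}).
Implicit Types dr : {ffun V -> nat} * {ffun V -> nat}.

Definition coconut_data dr : nat * seq nat * {ffun 'I_s -> nat} :=
  (dr.2 (inl ord_max), mkseq (fun k => dr.2 (inl (inord (n - k.+1)))) n,
   [ffun j => dr.2 (inr j)]).

Lemma rvec_coconut_data dr :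
  rvec n (coconut_data dr).1.1 (coconut_data dr).1.2 (coconut_data dr).2 = dr.2.
Proof.
apply/ffunP => -[i|j]; rewrite !ffunE //=.
have := ltn_ord i; case e : (n - i) => [|k] /= lt.
  by congr (dr.2 (inl _)); apply: val_inj => /=; lia.
rewrite nth_mkseq; last by lia.
by congr (dr.2 (inl _)); apply: val_inj; rewrite /= inordK; lia.
Qed.

Lemma coconut_dataK R c l d : size c = n ->
  coconut_data (d, rvec n R c l) = (R, c, l).
Proof.
move=> sz; rewrite /coconut_data /= ffunE subnn; congr (_, _, _); last first.
  by apply/ffunP => j; rewrite !ffunE.
apply: (@eq_from_nth _ 0); rewrite size_mkseq // => k kn.
rewrite nth_mkseq // ffunE inordK; last by lia.
by rewrite (_ : n - (n - k.+1) = k.+1) //; lia.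
Qed.

Definition chain_data : set (nat * seq nat * {ffun 'I_s -> nat}) :=
  [set x | [/\ core x.1.1 (head 0 x.1.2) x.2, chain x.1.1 x.1.2
             & size x.1.2 = n]].

Lemma Arith_chain_data dr : Arith (@coconut n.+1 s) dr ->
  chain_data (coconut_data dr) /\
  dr = (dvec n (coconut_data dr).1.1 (coconut_data dr).1.2 (coconut_data dr).2,
        dr.2).
Proof.
case: dr => d r Adr; have := rvec_coconut_data (d, r) => /= er.
have sz : size (coconut_data (d, r)).1.2 = n by rewrite size_mkseq.
move: Adr; rewrite -[in X in X -> _]er => /(Arith_rvec _ _ _ sz s_gt0)[h1 h2 ed].
by split; [split|rewrite -ed].
Qed.

Lemma coconut_data_inj dr dr' :
    Arith (@coconut n.+1 s) dr -> Arith (@coconut n.+1 s) dr' ->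
  coconut_data dr = coconut_data dr' -> dr = dr'.
Proof.
move=> /Arith_chain_data[_ e] /Arith_chain_data[_ e'] eq.
by rewrite e e' -!rvec_coconut_data eq.
Qed.

Lemma image_Arith : coconut_data @` Arith (@coconut n.+1 s) = chain_data.
Proof.
apply/seteqP; split=> [_ [dr /Arith_chain_data[? _] <-]//|[[R c] l] /= [h cc sz]].
exists (dvec n R c l, rvec n R c l); last exact: coconut_dataK.
by apply/Arith_rvec.
Qed.

Definition smooth_data : set (nat * seq nat * {ffun 'I_s -> nat}) :=
  [set x | [/\ chain_data x, path gtn x.1.1 x.1.2 & forall j, x.2 j < x.1.1]].

Lemma SArith_rvec R c l : chain_data (R, c, l) ->
  SArith (dvec n R c l, rvec n R c l) <-> smooth_data (R, c, l).
Proof.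
move=> cd; have [h cc sz] := cd; rewrite /= in h cc sz.
have ar : Arith (@coconut n.+1 s) (dvec n R c l, rvec n R c l) by apply/Arith_rvec.
have [/= _ r0 rE _] := ar.
have leaf j : (2 <= dvec n R c l (inr j)) = (l j < R).
  have := rE (inr j); have := r0 (inr j); rewrite sum_coconut_leaf ffunE.
  by move: (dvec _ _ _ _ _) => [|[|d]] l0 e; lia.
have inner (i : 'I_n.+1) : i.+1 < n.+1 -> (2 <= dvec n R c l (inl i)) =
    (2 * nth 0 c (n - i.+1) <= nth 0 (R :: c) (n - i.+1) + nth 0 c (n - i.+1).+1).
  move=> lt; have := rE (inl i); have := r0 (inl i).
  rewrite sum_coconut_path // ffunE ifT //.
  rewrite (_ : n - i = (n - i.+1).+1) /=; last by lia.
  by rewrite [X in _ = X]addnC => x0 <-; rewrite leq_pmul2r.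
split=> [[_ dp dl]|[_ /(chain_pathP cc) p lR]].
  split=> //= [|j]; last by rewrite -leaf.
  apply/(chain_pathP cc) => k; rewrite sz => kn.
  have lt : n - k.+1 < n.+1 by lia.
  have := dp (Ordinal lt); rewrite inner /=; last by lia.
  by rewrite (_ : n - (n - k.+1).+1 = k); [apply|]; lia.
split=> // [i lt|j] /=; last by rewrite leaf; apply: lR.
by rewrite inner //; apply: p; rewrite sz; lia.
Qed.

Lemma image_SArith : coconut_data @` @SArith n.+1 s = smooth_data.
Proof.
apply/seteqP; split=> [_ [dr sdr <-]|[[R c] l] sd].
  have [ar _ _] := sdr; have [cd e] := Arith_chain_data ar.
  have : SArith (dvec n (coconut_data dr).1.1 (coconut_data dr).1.2 (coconut_data dr).2,
                 rvec n (coconut_data dr).1.1 (coconut_data dr).1.2 (coconut_data dr).2).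
    by rewrite rvec_coconut_data -e.
  by move: cd; case: (coconut_data dr) => [[R c] l] cd /(SArith_rvec cd).
have [cd _ _] := sd.
exists (dvec n R c l, rvec n R c l); last by have [_ _ sz] := cd; apply: coconut_dataK.
by apply/SArith_rvec.
Qed.

Lemma finite_Arith_coconut : finite_set (Arith (@coconut n.+1 s)).
Proof.
by apply: finite_Arith => *; [apply: coconut_sym|apply: coconut_connected].
Qed.

Lemma finite_chain_data : finite_set chain_data.
Proof. by rewrite -image_Arith; apply/finite_image/finite_Arith_coconut. Qed.

Lemma ncard_Arith : ncard (Arith (@coconut n.+1 s)) = ncard chain_data.
Proof.
rewrite -image_Arith ncard_image //; first exact: finite_Arith_coconut.
exact: coconut_data_inj.
Qed.

Lemma ncard_SArith : ncard (@SArith n.+1 s) = ncard smooth_data.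
Proof.
rewrite -image_SArith ncard_image //.
  by apply: sub_finite_set finite_Arith_coconut => dr [].
by move=> dr dr' [? _ _] [? _ _]; apply: coconut_data_inj.
Qed.

(** * From chains to the triples (R, a, l) *)

Definition reduce (x : nat * seq nat * {ffun 'I_s -> nat}) :=
  (x.1.1, head 0 x.1.2 %% x.1.1, x.2).

Definition core_data : set (nat * nat * {ffun 'I_s -> nat}) :=
  [set x | [/\ core x.1.1 x.1.2 x.2, x.1.2 < x.1.1 & elen x.1.2 x.1.1 <= n]].

(** Ensures that a triple with at most [n] steps carries at least one chain, so that [reduce] is
    onto [core_data]. *)
Lemma cballot_gt0 m : m <= n -> 0 < cballot n m.
Proof.
move=> mn; rewrite /cballot mn -(ltn_pmul2l (ltn0Sn n)) ballotE ?leq_subr //.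
by rewrite muln0 muln_gt0 bin_gt0 leq_addr addn1.
Qed.

Lemma image_reduce : reduce @` chain_data = core_data.
Proof.
apply/seteqP; split=> [_ [[[R c] l] /= [h cc sz] <-]|[[R a] l] [/= h aR le]].
  have [R0 _ _ _] := h.
  split=> /=; [exact/core_modn|exact: ltn_pmod|].
  by rewrite -sz; apply: leq_trans (chain_elen R0 cc); apply: leq_addr.
have := cballot_gt0 le; rewrite -(size_chains n aR).
case e : (chains n a R) => [|c t] // _.
have : c \in chains n a R by rewrite e mem_head.
rewrite mem_chains // => /and3P[/eqP sz cc /eqP ha].
exists (R, c, l); last by rewrite /reduce /= ha.
by split=> //=; apply/core_modn; rewrite ha.
Qed.

Lemma finite_core_data : finite_set core_data.
Proof. by rewrite -image_reduce; apply/finite_image/finite_chain_data. Qed.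

(** The chain data are listed fibre by fibre over the triples, and [size_chains] counts each
    fibre. *)
Lemma ncard_chain_data :
  ncard chain_data = \sum_(x <- fset_set core_data) cballot n (elen x.1.2 x.1.1).
Proof.
pose L := [seq (x.1.1, c, x.2) | x <- fset_set core_data,
                                 c <- chains n x.1.2 x.1.1].
have memG x : x \in (fset_set core_data : seq _) <-> core_data x.
  by rewrite in_fset_set ?inE //; apply: finite_core_data.
rewrite (ncard_seq (s := L)).
- rewrite size_allpairs_dep sumnE big_map big_seq [RHS]big_seq.
  by apply: eq_bigr => x /memG[_ aR _]; apply: size_chains.
- apply: allpairs_uniq_dep; first exact: fset_uniq.
    by move=> x /memG[_ aR _]; apply: chains_uniq; apply: leq_ltn_trans aR.
  (* The residue of the head recovers the component a forgotten by the list, so distinct fibres do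
     not overlap. *)
  have headE x c : x \in (fset_set core_data : seq _) ->
      c \in chains n x.1.2 x.1.1 -> head 0 c %% x.1.1 = x.1.2.
    by move=> /memG[_ aR _]; rewrite mem_chains // => /and3P[_ _ /eqP].
  move=> y y' /allpairsPdep[[[R a] l] [c [xG /(headE _ _ xG) ca ->]]].
  move=> /allpairsPdep[[[R' a'] l'] [c' [xG' /(headE _ _ xG') ca' ->]]] /=.
  by move: ca ca' => /= <- <- [-> -> ->].
move=> [[R c] l]; split.
  move=> /allpairsPdep[[[R' a] l'] [c' [/memG[/= h aR le] + ]]].
  rewrite mem_chains // => /and3P[/eqP sz cc /eqP ha] [-> -> ->].
  by split=> //=; apply/core_modn; rewrite ha.
move=> cd; have [/= [R0 _ _ _] cc sz] := cd.
apply/allpairsPdep; exists (reduce (R, c, l)), c; split=> //.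
  by apply/memG; rewrite -image_reduce; exists (R, c, l).
by rewrite mem_chains /= ?ltn_pmod // sz cc !eqxx.
Qed.

Definition proper_core_data m : set (nat * nat * {ffun 'I_s -> nat}) :=
  [set x | [/\ core x.1.1 x.1.2 x.2, x.1.2 < x.1.1, elen x.1.2 x.1.1 = m
             & forall j, x.2 j < x.1.1]].

(** Over a triple with exactly [n] steps there are [cballot n n] = 1 chains, and by [chain_smooth]
    that chain is strictly decreasing. *)
Lemma ncard_smooth_data : ncard smooth_data = ncard (proper_core_data n).
Proof.
have smoothE R c l : smooth_data (R, c, l) ->
    head 0 c < R /\ c \in chains n (head 0 c) R /\ elen (head 0 c) R = n.
  move=> [[/= [R0 _ _ _] cc sz] p _].
  have hR : head 0 c < R by case: (c) p => //= ? ? /andP[].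
  move: p; rewrite -chain_smooth // modn_small // sz => /eqP e.
  by rewrite mem_chains // modn_small // sz cc !eqxx.
have -> : proper_core_data n = reduce @` smooth_data.
  apply/seteqP; split=> [[[R a] l] [/= h aR ea lR]|_ [[[R c] l] sd <-]].
    have : core_data (R, a, l) by split=> //=; rewrite ea.
    rewrite -image_reduce => -[[[R' c] l'] cd [eR ha el]]; subst R' l'.
    exists (R, c, l); last by rewrite /reduce /= ha.
    have [/= [R0 _ _ _] cc sz] := cd.
    by split=> //=; rewrite -chain_smooth // ha ea sz.
  have [hR [_ ea]] := smoothE _ _ _ sd; have [[/= h cc sz] _ lR] := sd.
  by split; rewrite /= ?modn_small.
rewrite ncard_image //; first by apply: sub_finite_set finite_chain_data => x [].
move=> [[R c] l] [[R' c'] l'] sd sd' [eR ha el]; subst R' l'.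
have [hR [cin ea]] := smoothE _ _ _ sd; have [hR' [cin' ea']] := smoothE _ _ _ sd'.
rewrite !modn_small // in ha; rewrite -ha in cin'.
have := size_chains n hR; rewrite ea /cballot leqnn subnn ballot0.
by case: chains cin cin' => [|x [|]] //; rewrite !inE => /eqP-> /eqP->.
Qed.

End Bijections.

(** * Dropping the leaves with label 1 and summing up *)

Lemma core_le s R a (l : {ffun 'I_s -> nat}) j : core R a l -> l j <= R.
Proof. by case=> R0 _ lR _; apply: dvdn_leq. Qed.

Section ProperLeaves.
Variables (n s : nat) (S : {set 'I_s}).

Definition support_data : set (nat * nat * {ffun 'I_s -> nat}) :=
  [set x | [/\ core x.1.1 x.1.2 x.2, x.1.2 < x.1.1, elen x.1.2 x.1.1 = n
             & [set j | x.2 j < x.1.1]%SET = S]].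

Definition restrict (x : nat * nat * {ffun 'I_s -> nat}) :
    nat * nat * {ffun 'I_#|S| -> nat} :=
  (x.1.1, x.1.2, [ffun j => x.2 (enum_val j)]).

Lemma sum_restrict R (l : {ffun 'I_s -> nat}) :
    (forall j, j \notin S -> l j = R) ->
  \sum_j l j = \sum_(j < #|S|) l (enum_val j) + #|~: S| * R.
Proof.
move=> lR; rewrite (bigID (mem S)) /= big_enum_val; congr (_ + _).
rewrite -sum_nat_const; apply: eq_big => j; first by rewrite inE.
exact: lR.
Qed.

Lemma core_restrict R a (l : {ffun 'I_s -> nat}) :
    (forall j, j \notin S -> l j = R) ->
  core R a [ffun j : 'I_#|S| => l (enum_val j)] <-> core R a l.
Proof.
move=> lR.
have all d : d %| R -> (forall j, d %| [ffun j : 'I_#|S| => l (enum_val j)] j) <->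
                       (forall j, d %| l j).
  move=> dR; split=> h j; last by rewrite ffunE.
  have [jS|/lR -> //] := boolP (j \in S).
  by have := h (enum_rank_in jS j); rewrite ffunE enum_rankK_in.
have sumE : (R %| a + \sum_j l j) =
            (R %| a + \sum_j [ffun j : 'I_#|S| => l (enum_val j)] j).
  rewrite (sum_restrict lR) addnA dvdn_addl ?dvdn_mull //.
  by congr (_ %| _ + _); apply: eq_bigr => j _; rewrite ffunE.
rewrite /core sumE.
split=> -[R0 Ra lR' g].
  split=> // [j|d dR da dl].
    have [jS|/lR -> //] := boolP (j \in S).
    by have := lR' (enum_rank_in jS j); rewrite ffunE enum_rankK_in.
  by apply: g => //; apply/(all d dR).
split=> // [j|d dR da dl]; first by rewrite ffunE.
by apply: g => //; apply/(all d dR).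
Qed.

Lemma support_data_out x j : support_data x -> j \notin S -> x.2 j = x.1.1.
Proof.
case=> h _ _ <-; rewrite inE -leqNgt => le.
by apply/eqP; rewrite eqn_leq le (core_le j h).
Qed.

Lemma image_restrict : restrict @` support_data = @proper_core_data #|S| n.
Proof.
apply/seteqP; split=> [_ [[[R a] l] sd <-]|[[R a] l'] [/= h aR ea lR]].
  have lR j := @support_data_out _ j sd; case: sd => /= h aR ea eS.
  split=> //= [|j]; first exact/core_restrict.
  by rewrite ffunE; have := enum_valP j; move: (enum_val j) => i; rewrite -eS inE.
(* Extends [l'] by [R] outside [S]: there [index] returns the length of the list, so [nth] falls
   back to its default [R]. *)
pose l := [ffun i : 'I_s => nth R [seq l' j | j <- enum 'I_#|S|] (index i (enum S))].
have lout j : j \notin S -> l j = R.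
  rewrite -mem_enum -index_mem -leqNgt => le.
  by rewrite ffunE nth_default // size_map size_enum_ord cardE.
have lin (j : 'I_#|S|) : l (enum_val j) = l' j.
  rewrite ffunE (enum_val_nth (enum_val j)) index_uniq ?enum_uniq -?cardE //.
  by rewrite (nth_map j) ?size_enum_ord // nth_ord_enum.
have er : [ffun j => l (enum_val j)] = l' by apply/ffunP => j; rewrite ffunE lin.
exists (R, a, l); last by rewrite /restrict /= er.
split=> //=; first by apply/(core_restrict _ lout); rewrite er.
apply/setP => j; rewrite inE; have [jS|/lout -> //] := boolP (j \in S).
  by have := lR (enum_rank_in jS j); rewrite -lin enum_rankK_in.
by rewrite ltnn.
Qed.

Lemma ncard_support_data : finite_set support_data ->
  ncard support_data = ncard (@proper_core_data #|S| n).
Proof.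
move=> fin; rewrite -image_restrict ncard_image //.
move=> [[R a] l] [[R' a'] l'] sd sd' [eR ea /ffunP el]; subst R' a'.
congr (_, _, _); apply/ffunP => j.
have [jS|jS] := boolP (j \in S).
  by have := el (enum_rank_in jS j); rewrite !ffunE enum_rankK_in.
by have /= := support_data_out sd jS; have /= := support_data_out sd' jS; move=> -> ->.
Qed.

End ProperLeaves.

Lemma sum_subsets (f : nat -> nat) s :
  \sum_(S : {set 'I_s}) f #|S| = \sum_(0 <= y < s.+1) 'C(s, y) * f y.
Proof.
rewrite (partition_big (fun S : {set 'I_s} => inord #|S| : 'I_s.+1) xpredT) //=.
rewrite big_mkord; apply: eq_bigr => y _.
have lt (S : {set 'I_s}) : #|S| < s.+1 by rewrite ltnS -[s in _ <= s]card_ord max_card.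
transitivity (\sum_(S in [set S : {set 'I_s} | #|S| == y]%SET) f y).
  apply: eq_big => S; first by rewrite inE -val_eqE /= inordK.
  by move=> /eqP <-; rewrite inordK.
by rewrite sum_nat_const card_draws card_ord.
Qed.

(** Sorts the triples by the set S of leaves with entry below R, then by the number m of steps. The
    size of a class depends on S only through its cardinality. *)
Lemma ncard_chain_data_sum n s : 0 < s ->
  ncard (@chain_data n s) = \sum_(0 <= y < s.+1) 'C(s, y) *
    \sum_(m < n.+1) cballot n m * ncard (@proper_core_data y m).
Proof.
move=> s0; rewrite ncard_chain_data //.
rewrite -(sum_subsets (fun y =>
  \sum_(m < n.+1) cballot n m * ncard (@proper_core_data y m))).
have memG x : x \in (fset_set (@core_data n s) : seq _) <-> @core_data n s x.
  by rewrite in_fset_set ?inE //; apply: finite_core_data.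
rewrite (partition_big (fun x : nat * nat * {ffun 'I_s -> nat} =>
  [set j | x.2 j < x.1.1]%SET) xpredT) //=.
apply: eq_bigr => S _.
rewrite (partition_big (fun x : nat * nat * {ffun 'I_s -> nat} =>
  inord (elen x.1.2 x.1.1) : 'I_n.+1) xpredT) //=.
apply: eq_bigr => m _.
have sub : support_data m S `<=` @core_data n s.
  by move=> x [h aR ea _]; split; rewrite // ea -ltnS.
rewrite -ncard_support_data; last exact: sub_finite_set sub (finite_core_data _ s0).
rewrite (@ncard_seq _ _
  [seq x : nat * nat * {ffun 'I_s -> nat} <- fset_set (@core_data n s) |
    ([set j | x.2 j < x.1.1]%SET == S) && (inord (elen x.1.2 x.1.1) == m)]).
- rewrite -big_filter big_seq (eq_bigr (fun=> cballot n m)).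
    by rewrite -big_seq big_const_seq count_predT iter_addn_0.
  move=> x; rewrite mem_filter => /andP[/andP[_ /eqP <-] /memG[_ _ le]].
  by rewrite inordK.
- by rewrite filter_uniq // fset_uniq.
move=> x; rewrite mem_filter; split.
  move=> /andP[/andP[/eqP eS /eqP em] /memG[h aR le]].
  by split=> //; rewrite -em inordK.
move=> sx; have := sub _ sx => /memG ->; case: sx => h aR -> ->.
by rewrite inord_val !eqxx.
Qed.

(** Without leaves R divides a < R, so a = 0, and the gcd clause forces R = 1. *)
Lemma ncard_proper0 m : ncard (@proper_core_data 0 m) = (m == 0).
Proof.
have P x : @proper_core_data 0 m x <-> m = 0 /\ x = (1, 0, [ffun=> 0]).
  case: x => [[R a] l]; split.
    move=> [/= [R0 Ra _ g] aR ea _].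
    have a0 : a = 0.
      by apply/eqP; move: Ra; rewrite big_ord0 addn0 /dvdn modn_small.
    subst a; rewrite -ea elen0; split=> //; congr (_, _, _).
      by apply: g => // -[].
    by apply/ffunP => -[].
  move=> [-> [-> -> ->]]; split=> //= [|[]//]; split=> // [[]//|d].
  by rewrite dvdn1 => /eqP.
case: (eqVneq m 0) => [m0|m0].
  rewrite (@ncard_seq _ _ [:: (1, 0, [ffun=> 0])]) // => x.
  by rewrite inE; split=> [/eqP ex|/P[_ ->] //]; apply/P.
rewrite (@ncard_seq _ _ [::]) // => x; rewrite in_nil; split=> // /P[e].
by rewrite e in m0.
Qed.

Lemma elen_pred a : elen a a.+1 = a.
Proof. by have := @elen_shift 0 1 a isT; rewrite !add0n !muln1. Qed.

(** The single leaf entry divides R and hence a, so it is 1. Then R divides a + 1 and a < R give R =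
    a + 1, with a steps; the leaf condition 1 < R excludes a = 0. *)
Lemma ncard_proper1 m : ncard (@proper_core_data 1 m) = (0 < m).
Proof.
have P x : @proper_core_data 1 m x <-> 0 < m /\ x = (m.+1, m, [ffun=> 1]).
  case: x => [[R a] l]; split.
    move=> [/= [R0 Ra lR g] aR ea lltR]; rewrite big_ord1 in Ra.
    have la : l ord0 %| a.
      by rewrite -(dvdn_addl _ (dvdnn (l ord0))); apply: dvdn_trans Ra.
    have l1 : l ord0 = 1 by apply: g => // j; rewrite ord1.
    have := lltR ord0; rewrite l1 in Ra * => R1.
    have eR : R = a.+1.
      by apply/eqP; rewrite eqn_leq aR andbT dvdn_leq // -addn1.
    subst R; rewrite elen_pred in ea; rewrite -ea; split=> //.
    by congr (_, _, _); apply/ffunP => j; rewrite ffunE ord1.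
  move=> [m0 [-> -> ->]]; split=> //= [||j]; [|exact: elen_pred|by rewrite ffunE].
  split=> // [|j|d _ _ /(_ ord0)]; rewrite ?big_ord1 ?ffunE ?addn1 ?dvd1n //.
  by rewrite dvdn1 => /eqP.
case: (posnP m) => [m0|m0].
  rewrite (@ncard_seq _ _ [::]) // => x; rewrite in_nil; split=> // /P[e].
  by rewrite m0 in e.
rewrite (@ncard_seq _ _ [:: (m.+1, m, [ffun=> 1])]) // => x.
by rewrite inE; split=> [/eqP ex|/P[_ ->] //]; apply/P.
Qed.

Lemma coefA_sum n y :
  \sum_(m < n.+1) cballot n m * ncard (@proper_core_data y m) =
  coefA (n.+1 + y) y.
Proof.
case: y => [|[|y]]; rewrite /coefA.
- rewrite big_ord_recl ncard_proper0 muln1 big1 ?addn0 => [|m _].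
    by rewrite cballot_catalan subn1.
  by rewrite ncard_proper0 muln0.
- rewrite big_ord_recl ncard_proper1 muln0 add0n.
  rewrite addn1 subn1 subn2 /= -!cballot_catalan cballotS0.
  (* The sum over all m is C_(n+1); the subtracted C_n is its term m = 0. *)
  rewrite -(@sum_cballot n 0 n.+1) // big_mkord big_ord_recl addKn.
  by apply: eq_bigr => m _; rewrite ncard_proper1 muln1.
(* The index i of [coefA] is m + [y.+3], so i - [y.+2] = m + 1 is the number of path vertices. *)
rewrite -(add0n y.+3) big_addn big_mkord.
rewrite (_ : _ - y.+3 = n.+1); last by lia.
apply: eq_bigr => m _; rewrite -ncard_smooth_data // -ncard_SArith //.
rewrite /cballot -ltnS ltn_ord; congr (_ * _); first by congr ballot; lia.
by rewrite (_ : m + y.+3 - y.+2 = m.+1) //; lia.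
Qed.

Theorem theorem4p9 (p s : nat) (hp : 1 <= p) (hs : 2 <= s) :
  finite_set (Arith (@coconut p s)) /\
  ncard (Arith (@coconut p s)) =
    \sum_(0 <= j < s.+1) 'C(s, j) * coefA (p + s - j) (s - j).
Proof.
case: p hp => // n _; split; first exact: finite_Arith_coconut.
rewrite ncard_Arith ?ncard_chain_data_sum; try lia.
(* The sum so far runs over the number of leaves with entry below R, while j counts those with entry
   R. *)
rewrite big_nat_rev /= !big_mkord; apply: eq_bigr => j _.
have js : j <= s by rewrite -ltnS.
by rewrite add0n subSS bin_sub // coefA_sum addnBA.
Qed.
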